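(* Over $\mathsf{RCA}_0$, $\mathsf{GST}_1$ implies $\mathsf{ADS}$.
   Context: A CSC space (formalized in second-order arithmetic) is a tuple $\langle X,\mathcal{U},k\rangle$ where $X\subseteq\mathbb{N}$; $\mathcal{U}=\langle U_n:n\in\mathbb{N}\rangle$ is a sequence of subsets of $X$ covering $X$; and $k:X\times\mathbb{N}\times\mathbb{N}\to\mathbb{N}$ is such that whenever $x\in U_m\cap U_n$, $x\in U_{k(x,m,n)}\subseteq U_m\cap U_n$. Write $U\in\mathcal{U}$ if $U=U_n$ for some $n$. It is infinite if $X$ is infinite; $T_1$ if for all $x\ne y$ in $X$ there are $U,V\in\mathcal{U}$ with $x\in U\setminus V$, $y\in V\setminus U$; discrete if $\{x\}\in\mathcal{U}$ for all $x\in X$; has the cofinite topology if $X$ is infinite and $U\in\mathcal{U}$ iff $U=\emptyset$ or $X\setminus U$ is finite. A subspace $Y\subseteq X$ has basis $\langle U_n\cap Y\rangle$. $\mathsf{GST}_1$: every infinite $T_1$ CSC space has an infinite subspace which is discrete or has the cofinite topology. $\mathsf{ADS}$: every infinite linear order $(L,\le_L)$ has an infinite ascending sequence (a subset $Y$ in which each element has only finitely many $\le_L$-predecessors in $Y$) or an infinite descending sequence (a subset $Y$ in which each element has only finitely many $\le_L$-successors in $Y$). *)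

(* Defs.v *)
From Stdlib Require Import List Arith.
Import ListNotations.

(** * Second-order arithmetic: syntax and provability

    Formulas are in de Bruijn style, with separate indices for number variables
    and for set variables.  As usual in second-order arithmetic, equality is
    primitive for numbers only. *)

Inductive term : Type :=
| tvar (i : nat)
| tzero
| tone
| tadd (s t : term)
| tmul (s t : term).

Inductive form : Type :=
| fbot
| feq (s t : term)
| flt (s t : term)
| fmem (t : term) (X : nat)
| fimp (p q : form)
| falln (p : form)
| falls (p : form).

Definition fneg p := fimp p fbot.
Definition fand p q := fneg (fimp p (fneg q)).
Definition for_ p q := fimp (fneg p) q.
Definition fiff p q := fand (fimp p q) (fimp q p).
Definition fexn p := fneg (falln (fneg p)).
Definition fexs p := fneg (falls (fneg p)).

Fixpoint tsubst (sigma : nat -> term) (t : term) : term :=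
  match t with
  | tvar i => sigma i
  | tzero => tzero
  | tone => tone
  | tadd s t => tadd (tsubst sigma s) (tsubst sigma t)
  | tmul s t => tmul (tsubst sigma s) (tsubst sigma t)
  end.

Definition tshift : term -> term := tsubst (fun i => tvar (S i)).

Definition upn (sigma : nat -> term) (i : nat) : term :=
  match i with 0 => tvar 0 | S i => tshift (sigma i) end.

Definition ups (rho : nat -> nat) (i : nat) : nat :=
  match i with 0 => 0 | S i => S (rho i) end.

(** Capture-avoiding simultaneous substitution: [sigma] acts on number variables,
    [rho] on set variables (the only set terms). *)
Fixpoint fsubst (sigma : nat -> term) (rho : nat -> nat) (p : form) : form :=
  match p with
  | fbot => fbot
  | feq s t => feq (tsubst sigma s) (tsubst sigma t)
  | flt s t => flt (tsubst sigma s) (tsubst sigma t)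
  | fmem t X => fmem (tsubst sigma t) (rho X)
  | fimp p q => fimp (fsubst sigma rho p) (fsubst sigma rho q)
  | falln p => falln (fsubst (upn sigma) rho p)
  | falls p => falls (fsubst sigma (ups rho) p)
  end.

Definition shiftn : form -> form := fsubst (fun i => tvar (S i)) (fun i => i).
Definition shifts : form -> form := fsubst tvar S.

Definition instn (t : term) : form -> form :=
  fsubst (fun i => match i with 0 => t | S i => tvar i end) (fun i => i).
Definition insts (X : nat) : form -> form :=
  fsubst tvar (fun i => match i with 0 => X | S i => i end).

(** [succ_inst p] is [p(n+1)], where [n] is the number variable 0. *)
Definition succ_inst : form -> form :=
  fsubst (fun i => match i with 0 => tadd (tvar 0) tone | S i => tvar (S i) end)
         (fun i => i).

(** Classical two-sorted natural deduction.  The context is shifted by the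
    introduction rules of the quantifiers but the axioms [T] are not: an axiom with
    free variables stands for its universal closure. *)
Inductive prv (T : form -> Prop) : list form -> form -> Prop :=
| prv_ax G p : T p -> prv T G p
| prv_hyp G p : In p G -> prv T G p
| prv_impI G p q : prv T (p :: G) q -> prv T G (fimp p q)
| prv_impE G p q : prv T G (fimp p q) -> prv T G p -> prv T G q
| prv_raa G p : prv T (fneg p :: G) fbot -> prv T G p
| prv_allnI G p : prv T (map shiftn G) p -> prv T G (falln p)
| prv_allnE G p t : prv T G (falln p) -> prv T G (instn t p)
| prv_allsI G p : prv T (map shifts G) p -> prv T G (falls p)
| prv_allsE G p X : prv T G (falls p) -> prv T G (insts X p)
| prv_refl G t : prv T G (feq t t)
| prv_leibniz G s t p :
    prv T G (feq s t) -> prv T G (instn s p) -> prv T G (instn t p).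

Definition provable (T : form -> Prop) (p : form) : Prop := prv T [] p.

Declare Scope prv_scope.
Notation "T ⊢ p" := (provable T p) (at level 75, no associativity) : prv_scope.

(** * Writing formulas with named variables

    A [tm], [sv] or [fm] is a term, set variable or formula that is still to be told
    under how many number binders ([d]) and set binders ([e]) it occurs.  A variable
    bound at level [l] has index [d - l - 1] at depth [d]; so binders can be
    written as functions, and [close] produces a de Bruijn sentence. *)

Definition tm := nat -> term.
Definition sv := nat -> nat.
Definition fm := nat -> nat -> form.

Definition close (P : fm) : form := P 0 0.

Definition mzero : tm := fun _ => tzero.
Definition mone : tm := fun _ => tone.
Definition madd (s t : tm) : tm := fun d => tadd (s d) (t d).
Definition mmul (s t : tm) : tm := fun d => tmul (s d) (t d).

Definition meq (s t : tm) : fm := fun d _ => feq (s d) (t d).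
Definition mlt (s t : tm) : fm := fun d _ => flt (s d) (t d).
Definition mmem (t : tm) (X : sv) : fm := fun d e => fmem (t d) (X e).
Definition mneg (P : fm) : fm := fun d e => fneg (P d e).
Definition mimp (P Q : fm) : fm := fun d e => fimp (P d e) (Q d e).
Definition mand (P Q : fm) : fm := fun d e => fand (P d e) (Q d e).
Definition mor (P Q : fm) : fm := fun d e => for_ (P d e) (Q d e).
Definition miff (P Q : fm) : fm := fun d e => fiff (P d e) (Q d e).
Definition malln (F : tm -> fm) : fm :=
  fun d e => falln (F (fun d' => tvar (d' - S d)) (S d) e).
Definition mexn (F : tm -> fm) : fm :=
  fun d e => fexn (F (fun d' => tvar (d' - S d)) (S d) e).
Definition malls (F : sv -> fm) : fm :=
  fun d e => falls (F (fun e' => e' - S e) d (S e)).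
Definition mexs (F : sv -> fm) : fm :=
  fun d e => fexs (F (fun e' => e' - S e) d (S e)).

Declare Scope fm_scope.
Delimit Scope fm_scope with fm.
Bind Scope fm_scope with fm.

Notation "0" := mzero : fm_scope.
Notation "1" := mone : fm_scope.
Notation "s + t" := (madd s t) : fm_scope.
Notation "s * t" := (mmul s t) : fm_scope.
Notation "s ≡ t" := (meq s t) (at level 70, no associativity) : fm_scope.
Notation "s ≺ t" := (mlt s t) (at level 70, no associativity) : fm_scope.
Notation "t ∈ X" := (mmem t X) (at level 70, no associativity) : fm_scope.
Notation "¬ P" := (mneg P) (at level 75, right associativity) : fm_scope.
Notation "P ∧ Q" := (mand P Q) (at level 80, right associativity) : fm_scope.
Notation "P ∨ Q" := (mor P Q) (at level 85, right associativity) : fm_scope.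
Notation "P ⇒ Q" := (mimp P Q) (at level 90, right associativity) : fm_scope.
Notation "P ⇔ Q" := (miff P Q) (at level 95, no associativity) : fm_scope.
Notation "∀n x .. y , P" := (malln (fun x => .. (malln (fun y => P)) ..))
  (at level 200, x binder, y binder, right associativity) : fm_scope.
Notation "∃n x .. y , P" := (mexn (fun x => .. (mexn (fun y => P)) ..))
  (at level 200, x binder, y binder, right associativity) : fm_scope.
Notation "∀s x .. y , P" := (malls (fun x => .. (malls (fun y => P)) ..))
  (at level 200, x binder, y binder, right associativity) : fm_scope.
Notation "∃s x .. y , P" := (mexs (fun x => .. (mexs (fun y => P)) ..))
  (at level 200, x binder, y binder, right associativity) : fm_scope.

(** * The theory RCA_0 *)

Definition basic_axioms : list fm :=
  [ (∀n m, ¬ m + 1 ≡ 0)%fm;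
    (∀n m n, m + 1 ≡ n + 1 ⇒ m ≡ n)%fm;
    (∀n m, m + 0 ≡ m)%fm;
    (∀n m n, m + (n + 1) ≡ (m + n) + 1)%fm;
    (∀n m, m * 0 ≡ 0)%fm;
    (∀n m n, m * (n + 1) ≡ (m * n) + m)%fm;
    (∀n m, ¬ m ≺ 0)%fm;
    (∀n m n, m ≺ n + 1 ⇔ (m ≺ n ∨ m ≡ n))%fm ].

(** In the bounded quantifiers the bound does not contain the quantified variable. *)
Inductive Delta00 : form -> Prop :=
| Delta00_bot : Delta00 fbot
| Delta00_eq s t : Delta00 (feq s t)
| Delta00_lt s t : Delta00 (flt s t)
| Delta00_mem t X : Delta00 (fmem t X)
| Delta00_imp p q : Delta00 p -> Delta00 q -> Delta00 (fimp p q)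
| Delta00_all t p :
    Delta00 p -> Delta00 (falln (fimp (flt (tvar 0) (tshift t)) p))
| Delta00_ex t p :
    Delta00 p -> Delta00 (fexn (fand (flt (tvar 0) (tshift t)) p)).

Definition Sigma01 (p : form) : Prop := exists q, Delta00 q /\ p = fexn q.
Definition Pi01 (p : form) : Prop := exists q, Delta00 q /\ p = falln q.

(** In the two schemes the number variable 0 of [p] and [q] is the distinguished
    one; all their other free variables are parameters. *)
Definition induction_ax (p : form) : form :=
  fimp (fand (instn tzero p) (falln (fimp p (succ_inst p)))) (falln p).

Definition comprehension_ax (p q : form) : form :=
  fimp (falln (fiff p q)) (fexs (falln (fiff (fmem (tvar 0) 0) (shifts p)))).

Inductive RCA0 : form -> Prop :=
| RCA0_basic P : In P basic_axioms -> RCA0 (close P)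
| RCA0_induction p : Sigma01 p -> RCA0 (induction_ax p)
| RCA0_comprehension p q : Sigma01 p -> Pi01 q -> RCA0 (comprehension_ax p q).

(** * GST_1 and ADS *)

Open Scope fm_scope.

(** The pairing function of RCA_0, [(i,j) = (i+j)^2 + i]. *)
Definition pair (i j : tm) : tm := (i + j) * (i + j) + i.

(** Classes of numbers, and families of classes: [B x n] reads "[x] belongs to the
    [n]-th member of [B]".  They are formulas of the language, not set variables. *)
Definition cls := tm -> fm.
Definition fam := tm -> tm -> fm.

Definition elts (X : sv) : cls := fun x => x ∈ X.

(** A set [U] codes the sequence of the sets [U_n = {x : (x,n) ∈ U}]. *)
Definition row (U : sv) : fam := fun x n => pair x n ∈ U.

Definition Subset (A B : cls) : fm := ∀n x, A x ⇒ B x.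
Definition Finite (A : cls) : fm := ∃n b, ∀n x, A x ⇒ x ≺ b.
Definition Infinite (A : cls) : fm := ¬ Finite A.

Definition triple (x m n : tm) : tm := pair (pair x m) n.

(** The set [k] is (the graph of) a function from [X × ℕ × ℕ] to [ℕ]. *)
Definition Function3 (X k : sv) : fm :=
  (∀n z, z ∈ k ⇒ ∃n x m n j, x ∈ X ∧ z ≡ pair (triple x m n) j) ∧
  (∀n x m n, x ∈ X ⇒
     ∃n j, pair (triple x m n) j ∈ k ∧
           ∀n i, pair (triple x m n) i ∈ k ⇒ i ≡ j).

Definition CSC (X U k : sv) : fm :=
  (∀n i, Subset (fun x => row U x i) (elts X)) ∧
  (∀n x, x ∈ X ⇒ ∃n i, row U x i) ∧
  Function3 X k ∧
  (∀n x m n, row U x m ∧ row U x n ⇒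
     ∀n j, pair (triple x m n) j ∈ k ⇒
       row U x j ∧ Subset (fun z => row U z j) (fun z => row U z m ∧ row U z n)).

Definition T1 (X : cls) (B : fam) : fm :=
  ∀n x y, X x ∧ X y ∧ ¬ x ≡ y ⇒
    ∃n m n, (B x m ∧ ¬ B x n) ∧ (B y n ∧ ¬ B y m).

Definition Discrete (X : cls) (B : fam) : fm :=
  ∀n x, X x ⇒ ∃n i, ∀n z, B z i ⇔ z ≡ x.

(** [V] is open in the topology generated by the basis [B]. *)
Definition Open (B : fam) (V : sv) : fm :=
  ∀n x, x ∈ V ⇒ ∃n i, B x i ∧ Subset (fun z => B z i) (elts V).

(** "[U] is in the topology iff [U] is empty or cofinite" refers to the open sets and
    not to the listed basis.  With the listed basis GST_1 would be refutable: no
    infinite subspace of [ℕ] with basis the sets [ℕ \ F], [F] finite, has the empty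
    set in its basis, and none is discrete.  A space whose listed basis consists of
    exactly the empty set and the cofinite sets satisfies the condition below. *)
Definition Cofinite_topology (X : cls) (B : fam) : fm :=
  Infinite X ∧
  ∀s V, Subset (elts V) X ⇒
    (Open B V ⇔ ((∀n x, ¬ x ∈ V) ∨ Finite (fun x => X x ∧ ¬ x ∈ V))).

Definition subspace (B : fam) (Y : sv) : fam := fun x n => B x n ∧ x ∈ Y.

Definition GST1 : form := close (
  ∀s X U k, CSC X U k ∧ Infinite (elts X) ∧ T1 (elts X) (row U) ⇒
    ∃s Y, Subset (elts Y) (elts X) ∧ Infinite (elts Y) ∧
      (Discrete (elts Y) (subspace (row U) Y) ∨
       Cofinite_topology (elts Y) (subspace (row U) Y))).

(** [R] is the relation [≤_L], a set of pairs of elements of [L]. *)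
Definition Linear_order (L R : sv) : fm :=
  (∀n z, z ∈ R ⇒ ∃n x y, x ∈ L ∧ y ∈ L ∧ z ≡ pair x y) ∧
  (∀n x, x ∈ L ⇒ pair x x ∈ R) ∧
  (∀n x y, pair x y ∈ R ∧ pair y x ∈ R ⇒ x ≡ y) ∧
  (∀n x y z, pair x y ∈ R ∧ pair y z ∈ R ⇒ pair x z ∈ R) ∧
  (∀n x y, x ∈ L ∧ y ∈ L ⇒ pair x y ∈ R ∨ pair y x ∈ R).

Definition Ascending (R Y : sv) : fm :=
  ∀n y, y ∈ Y ⇒ Finite (fun z => z ∈ Y ∧ pair z y ∈ R).

Definition Descending (R Y : sv) : fm :=
  ∀n y, y ∈ Y ⇒ Finite (fun z => z ∈ Y ∧ pair y z ∈ R).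

Definition ADS : form := close (
  ∀s L R, Linear_order L R ∧ Infinite (elts L) ⇒
    ∃s Y, Subset (elts Y) (elts L) ∧ Infinite (elts Y) ∧
      (Ascending R Y ∨ Descending R Y)).

Close Scope fm_scope.
Open Scope prv_scope.

(* Main.v *)
(** By completeness it suffices to argue in an arbitrary model of RCA_0.  Given a linear
    order L, take as basic open sets U_(x,b) = {x} ∪ {z ≤_L x : b ≤ z} for x in L and b in ℕ.
    If y lies in U_(x,b) and U_(x',b'), then U_(y,c) is contained in both as soon as
    c ≥ b, b', so this is a CSC space; and U_(x,y+1) separates x from y ≠ x.  If a subspace Y
    is discrete, some U_(a,b) meets Y in {x} only, so all points of Y below x other than x
    are < b, and Y is ascending.  If Y has the cofinite topology, then {z ∈ Y : z ≤_L y} is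
    open and nonempty for y in Y, so Y has only finitely many points above y and is
    descending.

    Completeness is proved by Henkin's method.  Consistent contexts stay finite, so that a
    variable not occurring in the context is always available as a witness; the axioms do
    not interfere because they stand for their universal closures. *)

From Stdlib Require Import List Arith Lia Cantor Ring.
From Stdlib Require Import Classical ClassicalEpsilon FunctionalExtensionality
  PropExtensionality ProofIrrelevance.
Import ListNotations.
Require Import Defs.

(** * Substitution *)

Definition scons {A} (a : A) (f : nat -> A) (i : nat) : A :=
  match i with 0 => a | S i => f i end.

Lemma tsubst_id t : tsubst tvar t = t.
Proof. induction t; cbn; congruence. Qed.

Lemma tsubst_comp tau sigma t :
  tsubst tau (tsubst sigma t) = tsubst (fun i => tsubst tau (sigma i)) t.
Proof. induction t; cbn; congruence. Qed.

Lemma upn_id : upn tvar = tvar.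
Proof. extensionality i. now destruct i. Qed.

Lemma ups_id : ups (fun i => i) = fun i => i.
Proof. extensionality i. now destruct i. Qed.

Lemma fsubst_id p : fsubst tvar (fun i => i) p = p.
Proof.
  induction p; cbn; rewrite ?tsubst_id, ?upn_id, ?ups_id; congruence.
Qed.

Lemma upn_comp tau sigma :
  (fun i => tsubst (upn tau) (upn sigma i)) = upn (fun i => tsubst tau (sigma i)).
Proof.
  extensionality i. destruct i as [|i]; cbn; [easy|].
  unfold tshift. now rewrite !tsubst_comp.
Qed.

Lemma ups_comp pi rho : (fun i => ups pi (ups rho i)) = ups (fun i => pi (rho i)).
Proof. extensionality i. now destruct i. Qed.

Lemma fsubst_comp tau pi sigma rho p :
  fsubst tau pi (fsubst sigma rho p) =
  fsubst (fun i => tsubst tau (sigma i)) (fun i => pi (rho i)) p.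
Proof.
  revert tau pi sigma rho.
  induction p; intros; cbn; rewrite ?tsubst_comp, ?IHp, ?IHp1, ?IHp2,
    ?upn_comp, ?ups_comp; reflexivity.
Qed.

(** [upn] keeps index 0 free for the instantiating term, so the two substitutions merge into one.
    This lets an instance be traded for an extended assignment in the truth lemma. *)
Lemma instn_fsubst_upn t sigma rho p :
  instn t (fsubst (upn sigma) rho p) = fsubst (scons t sigma) rho p.
Proof.
  unfold instn. rewrite fsubst_comp. f_equal. extensionality i.
  destruct i as [|i]; cbn; [easy|].
  unfold tshift. rewrite tsubst_comp. apply tsubst_id.
Qed.

Lemma insts_fsubst_ups X sigma rho p :
  insts X (fsubst sigma (ups rho) p) = fsubst sigma (scons X rho) p.
Proof.
  unfold insts. rewrite fsubst_comp. f_equal.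
  - extensionality i. apply tsubst_id.
  - extensionality i. now destruct i.
Qed.

Lemma fsubst_instn sigma rho t p :
  fsubst sigma rho (instn t p) = instn (tsubst sigma t) (fsubst (upn sigma) rho p).
Proof.
  rewrite instn_fsubst_upn. unfold instn. rewrite fsubst_comp. f_equal.
  extensionality i. now destruct i.
Qed.

Lemma fsubst_insts sigma rho X p :
  fsubst sigma rho (insts X p) = insts (rho X) (fsubst sigma (ups rho) p).
Proof.
  rewrite insts_fsubst_ups. unfold insts. rewrite fsubst_comp. f_equal.
  extensionality i. now destruct i.
Qed.

Lemma fsubst_shiftn sigma rho p :
  fsubst (upn sigma) rho (shiftn p) = shiftn (fsubst sigma rho p).
Proof. unfold shiftn. now rewrite !fsubst_comp. Qed.

Lemma fsubst_shifts sigma rho p :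
  fsubst sigma (ups rho) (shifts p) = shifts (fsubst sigma rho p).
Proof.
  unfold shifts. rewrite !fsubst_comp. f_equal.
  extensionality i. cbn. now rewrite tsubst_id.
Qed.

(** The free number variables of [p] are below [n], the free set variables below [m]. *)
Definition fbound (n m : nat) (p : form) : Prop :=
  forall sigma sigma' rho rho',
    (forall i, i < n -> sigma i = sigma' i) ->
    (forall i, i < m -> rho i = rho' i) ->
    fsubst sigma rho p = fsubst sigma' rho' p.

Lemma fbound_mono n m n' m' p : n <= n' -> m <= m' -> fbound n m p -> fbound n' m' p.
Proof. intros Hn Hm H s s' r r' Hs Hr.
  apply H; intros i Hi; [apply Hs|apply Hr]; lia. Qed.

Lemma fbound_alln n m p : fbound (S n) m p -> fbound n m (falln p).
Proof.
  intros H s s' r r' Hs Hr. cbn. f_equal. apply H; auto.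
  intros [|i] Hi; cbn; [easy|]. rewrite Hs; auto with arith.
Qed.

Lemma fbound_alls n m p : fbound n (S m) p -> fbound n m (falls p).
Proof.
  intros H s s' r r' Hs Hr. cbn. f_equal. apply H; auto.
  intros [|i] Hi; cbn; [easy|]. rewrite Hr; auto with arith.
Qed.

Lemma tbound_ex t :
  exists n, forall s s', (forall i, i < n -> s i = s' i) -> tsubst s t = tsubst s' t.
Proof.
  induction t as [i| | |t1 [n1 H1] t2 [n2 H2]|t1 [n1 H1] t2 [n2 H2]].
  - exists (S i). cbn. auto.
  - now exists 0.
  - now exists 0.
  - exists (n1 + n2). intros s s' H. cbn.
    f_equal; [apply H1|apply H2]; intros i Hi; apply H; lia.
  - exists (n1 + n2). intros s s' H. cbn.
    f_equal; [apply H1|apply H2]; intros i Hi; apply H; lia.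
Qed.

Lemma fbound_ex p : exists k, fbound k k p.
Proof.
  induction p as [|t1 t2|t1 t2|t X|p [k1 H1] q [k2 H2]|p [k H]|p [k H]].
  - now exists 0.
  - destruct (tbound_ex t1) as [n1 H1], (tbound_ex t2) as [n2 H2].
    exists (n1 + n2). intros s s' r r' Hs Hr. cbn.
    f_equal; [apply H1|apply H2]; intros i Hi; apply Hs; lia.
  - destruct (tbound_ex t1) as [n1 H1], (tbound_ex t2) as [n2 H2].
    exists (n1 + n2). intros s s' r r' Hs Hr. cbn.
    f_equal; [apply H1|apply H2]; intros i Hi; apply Hs; lia.
  - destruct (tbound_ex t) as [n H]. exists (n + S X). intros s s' r r' Hs Hr. cbn.
    f_equal; [apply H; intros i Hi; apply Hs|apply Hr]; lia.
  - exists (k1 + k2). intros s s' r r' Hs Hr. cbn.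
    f_equal; [apply H1|apply H2]; intros i Hi; auto with arith; (apply Hs || apply Hr); lia.
  - exists k. apply fbound_alln. eapply fbound_mono; [| |exact H]; lia.
  - exists k. apply fbound_alls. eapply fbound_mono; [| |exact H]; lia.
Qed.

Lemma fbound_list_ex G : exists k, forall p, In p G -> fbound k k p.
Proof.
  induction G as [|p G [k H]]; [now exists 0|].
  destruct (fbound_ex p) as [l Hl]. exists (k + l).
  intros q [<-|Hq]; (eapply fbound_mono; [| |eauto]); lia.
Qed.

(** * Derived rules *)

Section Derivations.
Variable T : form -> Prop.

Lemma prv_weak G G' p : prv T G p -> incl G G' -> prv T G' p.
Proof.
  intros H. revert G'. induction H; intros G' HG.
  - now apply prv_ax.
  - apply prv_hyp; auto.
  - apply prv_impI, IHprv. intros x [->|Hx]; [now left|right; auto].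
  - eapply prv_impE; eauto.
  - apply prv_raa, IHprv. intros x [->|Hx]; [now left|right; auto].
  - apply prv_allnI, IHprv. now apply incl_map.
  - apply prv_allnE; auto.
  - apply prv_allsI, IHprv. now apply incl_map.
  - apply prv_allsE; auto.
  - apply prv_refl.
  - eapply prv_leibniz; eauto.
Qed.

Fixpoint alln_iter n p := match n with 0 => p | S n => falln (alln_iter n p) end.
Fixpoint alls_iter n p := match n with 0 => p | S n => falls (alls_iter n p) end.

(** The quantifiers are removed from the outside in, and the outermost of [n] receives
    [sigma (n - 1)]; after all of them the substitution is [sigma] itself. *)
Lemma alln_iter_E n G p sigma rho :
  prv T G (fsubst (fun i => sigma (n + i)) rho (alln_iter n p)) ->
  prv T G (fsubst sigma rho p).
Proof.
  induction n as [|n IH]; cbn [alln_iter]; intros H; [exact H|].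
  apply IH. cbn in H. apply prv_allnE with (t := sigma n) in H.
  rewrite instn_fsubst_upn in H.
  replace (fun i => sigma (n + i)) with (scons (sigma n) (fun i => sigma (S (n + i))));
    [exact H|].
  extensionality i. destruct i as [|i]; cbn; f_equal; lia.
Qed.

Lemma alls_iter_E n G p sigma rho :
  prv T G (fsubst sigma (fun i => rho (n + i)) (alls_iter n p)) ->
  prv T G (fsubst sigma rho p).
Proof.
  induction n as [|n IH]; cbn [alls_iter]; intros H; [exact H|].
  apply IH. cbn in H. apply prv_allsE with (X := rho n) in H.
  rewrite insts_fsubst_ups in H.
  replace (fun i => rho (n + i)) with (scons (rho n) (fun i => rho (S (n + i))));
    [exact H|].
  extensionality i. destruct i as [|i]; cbn; f_equal; lia.
Qed.

Lemma fbound_alln_iter k n m p : fbound (k + n) m p -> fbound n m (alln_iter k p).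
Proof.
  revert n. induction k as [|k IH]; intros n H; [exact H|].
  apply fbound_alln, IH. now rewrite Nat.add_succ_r.
Qed.

Lemma fbound_alls_iter k n m p : fbound n (k + m) p -> fbound n m (alls_iter k p).
Proof.
  revert m. induction k as [|k IH]; intros m H; [exact H|].
  apply fbound_alls, IH. now rewrite Nat.add_succ_r.
Qed.

(* The universal closure of an axiom is derivable and invariant under substitution. *)
Lemma prv_ax_subst p G sigma rho : T p -> prv T G (fsubst sigma rho p).
Proof.
  intros Hp. destruct (fbound_ex p) as [k Hk].
  apply (alls_iter_E k), (alln_iter_E k).
  assert (Hc : fbound 0 0 (alln_iter k (alls_iter k p))).
  { apply fbound_alln_iter, fbound_alls_iter. now rewrite !Nat.add_0_r. }
  (* The closure has no free variables, so the substitution acts on it as the identity. The closure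
     itself follows by generalization in any context, since axioms are available in all contexts. *)
  rewrite (Hc _ tvar _ (fun i => i)), fsubst_id by (intros; lia).
  assert (Hs : forall m G', prv T G' (alls_iter m p)).
  { induction m as [|m IH]; intros G'; [now apply prv_ax|apply prv_allsI, IH]. }
  assert (Hn : forall n G', prv T G' (alln_iter n (alls_iter k p))).
  { induction n as [|n IH]; intros G'; [apply Hs|apply prv_allnI, IH]. }
  apply Hn.
Qed.

(** [T] need not be closed under substitution; the axiom case goes through the universal closure.
    The substitution is generalized in the induction because it is lifted under quantifiers. *)
Lemma prv_subst G p sigma rho :
  prv T G p -> prv T (map (fsubst sigma rho) G) (fsubst sigma rho p).
Proof.
  intros H. revert sigma rho.
  induction H as [G p H|G p H|G p q H IH|G p q H1 IH1 H2 IH2|G p H IH|G p H IH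
    |G p t H IH|G p H IH|G p X H IH|G t|G s t p H1 IH1 H2 IH2]; intros sigma rho.
  - now apply prv_ax_subst.
  - now apply prv_hyp, in_map.
  - apply prv_impI, IH.
  - exact (prv_impE _ _ _ _ (IH1 sigma rho) (IH2 sigma rho)).
  - apply prv_raa, IH.
  - apply prv_allnI. specialize (IH (upn sigma) rho).
    rewrite map_map in IH |- *. erewrite map_ext; [exact IH|].
    intros q. cbn. now rewrite fsubst_shiftn.
  - rewrite fsubst_instn. apply prv_allnE, IH.
  - apply prv_allsI. specialize (IH sigma (ups rho)).
    rewrite map_map in IH |- *. erewrite map_ext; [exact IH|].
    intros q. cbn. now rewrite fsubst_shifts.
  - rewrite fsubst_insts. apply prv_allsE, IH.
  - apply prv_refl.
  - rewrite fsubst_instn. apply prv_leibniz with (s := tsubst sigma s).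
    + apply IH1.
    + rewrite <- fsubst_instn. apply IH2.
Qed.

(** Renaming the fresh variable [k] to 0 and shifting all others turns a derivation of the instance
    at [k] into the premise of [prv_allnI]. *)
Lemma prv_alln_fresh k G p :
  (forall q, In q G -> fbound k k q) -> fbound k k p ->
  prv T G (instn (tvar k) p) -> prv T G (falln p).
Proof.
  intros HG Hp H. apply prv_allnI.
  set (sigma := fun i => if i =? k then tvar 0 else tvar (S i)).
  apply (prv_subst _ _ sigma (fun i => i)) in H.
  replace (fsubst sigma (fun i => i) (instn (tvar k) p)) with p in H.
  - erewrite map_ext_in; [exact H|]. intros q Hq.
    apply (HG q Hq); intros i Hi; [|easy]. unfold sigma.
    now destruct (Nat.eqb_spec i k); [lia|].
  - unfold instn. rewrite fsubst_comp. rewrite <- (fsubst_id p) at 1.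
    apply Hp; [|easy]. intros [|i] Hi; cbn; unfold sigma.
    + now rewrite Nat.eqb_refl.
    + now destruct (Nat.eqb_spec i k); [lia|].
Qed.

Lemma prv_alls_fresh k G p :
  (forall q, In q G -> fbound k k q) -> fbound k k p ->
  prv T G (insts k p) -> prv T G (falls p).
Proof.
  intros HG Hp H. apply prv_allsI.
  set (rho := fun i => if i =? k then 0 else S i).
  apply (prv_subst _ _ tvar rho) in H.
  replace (fsubst tvar rho (insts k p)) with p in H.
  - erewrite map_ext_in; [exact H|]. intros q Hq.
    apply (HG q Hq); intros i Hi; [easy|]. unfold rho.
    now destruct (Nat.eqb_spec i k); [lia|].
  - unfold insts. rewrite fsubst_comp. rewrite <- (fsubst_id p) at 1.
    apply Hp; [easy|]. intros [|i] Hi; cbn; unfold rho.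
    + now rewrite Nat.eqb_refl.
    + now destruct (Nat.eqb_spec i k); [lia|].
Qed.

Lemma prv_cut G G' p : (forall q, In q G -> prv T G' q) -> prv T G p -> prv T G' p.
Proof.
  revert p. induction G as [|q G IH]; intros p HG H.
  - now apply (prv_weak [] G').
  - apply prv_impE with q; [|apply HG; now left].
    apply IH; [intros r Hr; apply HG; now right|now apply prv_impI].
Qed.

(** * Completeness *)

Definition consistent (G : list form) : Prop := ~ prv T G fbot.

Lemma consistent_neg G p : ~ prv T G p -> consistent (fneg p :: G).
Proof. intros H H'. now apply H, prv_raa. Qed.

(** One stage of the Henkin construction. Witnesses appear as refuted instances of universal
    formulas, because the existential quantifiers are defined ones. *)
Definition decides_with_witness (G : list form) (p : form) (D : list form) : Prop :=
  consistent D /\ incl G D /\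
  (prv T D p \/ prv T D (fneg p)) /\
  (forall q, p = falln q -> prv T D p \/ exists t, prv T D (fneg (instn t q))) /\
  (forall q, p = falls q -> prv T D p \/ exists X, prv T D (fneg (insts X q))).

(** If [p] is not derivable, its negation is added, and for a universal [p] also the negation of its
    instance at a fresh variable. Were that instance derivable, generalization would derive [p] and
    contradict consistency. *)
Lemma decides_with_witness_ex G p :
  consistent G -> exists D, decides_with_witness G p D.
Proof.
  intros HG. destruct (classic (prv T G p)) as [Hp|Hp].
  { exists G. repeat split; auto using incl_refl. }
  assert (Hwit : forall r, ~ prv T (fneg p :: G) r ->
      exists D, consistent D /\ incl G D /\ prv T D (fneg p) /\ prv T D (fneg r)).
  { intros r Hr. exists (fneg r :: fneg p :: G). split; [now apply consistent_neg|].
    repeat split; [intros x Hx|apply prv_hyp|apply prv_hyp]; cbn; auto. }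
  assert (Hgen : forall q, ~ prv T (fneg (falln q) :: G) (falln q) ->
      exists k, ~ prv T (fneg (falln q) :: G) (instn (tvar k) q)).
  { intros q Hq. destruct (fbound_list_ex (q :: fneg (falln q) :: G)) as [k Hk].
    exists k. intros H. apply Hq, (prv_alln_fresh k); auto; [|apply Hk; now left].
    intros r Hr. apply Hk. now right. }
  assert (Hges : forall q, ~ prv T (fneg (falls q) :: G) (falls q) ->
      exists k, ~ prv T (fneg (falls q) :: G) (insts k q)).
  { intros q Hq. destruct (fbound_list_ex (q :: fneg (falls q) :: G)) as [k Hk].
    exists k. intros H. apply Hq, (prv_alls_fresh k); auto; [|apply Hk; now left].
    intros r Hr. apply Hk. now right. }
  assert (Hn : ~ prv T (fneg p :: G) p).
  { intros H. apply (consistent_neg _ _ Hp). apply prv_impE with p; [|exact H].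
    apply prv_hyp. now left. }
  destruct p as [|s t|s t|t X|q r|q|q].
  6: { destruct (Hgen _ Hn) as [k Hk]. destruct (Hwit _ Hk) as (D & H1 & H2 & H3 & H4).
       exists D. repeat split; auto; [|discriminate].
       intros q' [= <-]. eauto. }
  6: { destruct (Hges _ Hn) as [k Hk]. destruct (Hwit _ Hk) as (D & H1 & H2 & H3 & H4).
       exists D. repeat split; auto; [discriminate|].
       intros q' [= <-]. eauto. }
  all: destruct (Hwit _ Hn) as (D & H1 & H2 & H3 & H4);
    exists D; repeat split; auto; discriminate.
Qed.

End Derivations.

(** * Enumeration of formulas *)

Fixpoint code_term (t : term) : nat :=
  match t with
  | tvar i => to_nat (0, i)
  | tzero => to_nat (1, 0)
  | tone => to_nat (2, 0)
  | tadd s t => to_nat (3, to_nat (code_term s, code_term t))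
  | tmul s t => to_nat (4, to_nat (code_term s, code_term t))
  end.

Fixpoint code_form (p : form) : nat :=
  match p with
  | fbot => to_nat (0, 0)
  | feq s t => to_nat (1, to_nat (code_term s, code_term t))
  | flt s t => to_nat (2, to_nat (code_term s, code_term t))
  | fmem t X => to_nat (3, to_nat (code_term t, X))
  | fimp p q => to_nat (4, to_nat (code_form p, code_form q))
  | falln p => to_nat (5, code_form p)
  | falls p => to_nat (6, code_form p)
  end.

Ltac split_codes :=
  repeat match goal with
  | H : to_nat _ = to_nat _ |- _ =>
      apply to_nat_inj, pair_equal_spec in H; destruct H; try discriminate
  end.

Lemma code_term_inj s t : code_term s = code_term t -> s = t.
Proof.
  revert t. induction s; intros []; cbn -[to_nat]; intros H; split_codes; subst;
    f_equal; auto.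
Qed.

Lemma code_form_inj p q : code_form p = code_form q -> p = q.
Proof.
  revert q. induction p; intros []; cbn -[to_nat]; intros H; split_codes; subst;
    f_equal; auto using code_term_inj.
Qed.

(** The coding is inverted by choice; a number that codes no formula yields an arbitrary one, which
    does no harm. *)
Definition enum_form (n : nat) : form :=
  epsilon (inhabits fbot) (fun p => code_form p = n).

Lemma enum_form_surj p : exists n, enum_form n = p.
Proof.
  exists (code_form p). apply code_form_inj. unfold enum_form.
  now apply epsilon_spec with (P := fun q => code_form q = code_form p); exists p.
Qed.

(** * Henkin sets *)

Record henkin (T Omega : form -> Prop) : Prop := {
  henkin_prv G p : (forall q, In q G -> Omega q) -> prv T G p -> Omega p;
  henkin_bot : ~ Omega fbot;
  henkin_decides p : Omega p \/ Omega (fneg p);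
  henkin_alln p : Omega (falln p) \/ exists t, Omega (fneg (instn t p));
  henkin_alls p : Omega (falls p) \/ exists X, Omega (fneg (insts X p))
}.

(** Starting from the negation of [p], stage [n] settles the [n]-th formula by a finite extension.
    [Omega] consists of what is derivable from some stage. *)
Lemma lindenbaum T p : ~ T ⊢ p -> exists Omega, henkin T Omega /\ Omega (fneg p).
Proof.
  intros Hp.
  set (step := fun G n => epsilon (inhabits nil) (decides_with_witness T G (enum_form n))).
  assert (Hstep : forall G n, consistent T G ->
      decides_with_witness T G (enum_form n) (step G n)).
  { intros G n HG. apply epsilon_spec. now apply decides_with_witness_ex. }
  set (chain := nat_rect (fun _ => list form) [fneg p] (fun n G => step G n)).
  assert (Hc : forall n, consistent T (chain n)).
  { induction n as [|n IH]; [now apply consistent_neg|]. apply (Hstep _ n IH). }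
  assert (Hd : forall n, decides_with_witness T (chain n) (enum_form n) (chain (S n))).
  { intros n. apply Hstep, Hc. }
  assert (Hincl : forall n m, incl (chain n) (chain (n + m))).
  { intros n m. induction m as [|m IH]; [rewrite Nat.add_0_r; apply incl_refl|].
    rewrite Nat.add_succ_r. eapply incl_tran; [exact IH|]. apply (Hd (n + m)). }
  assert (Hmono : forall n m q, n <= m -> prv T (chain n) q -> prv T (chain m) q).
  { intros n m q Hnm H. eapply prv_weak; [exact H|].
    replace m with (n + (m - n)) by lia. apply Hincl. }
  exists (fun q => exists n, prv T (chain n) q). split; [split|].
  - intros G q HG H.
    (* Finitely many members of the union are all derivable from one common stage. *)
    assert (HG' : exists n, forall r, In r G -> prv T (chain n) r).
    { clear H. induction G as [|r G IH]; [exists 0; intros r []|].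
      destruct IH as [n Hn]; [intros r' Hr'; apply HG; now right|].
      destruct (HG r) as [m Hm]; [now left|].
      exists (n + m). intros r' [<-|Hr'].
      - apply (Hmono m); [lia|exact Hm].
      - apply (Hmono n); [lia|now apply Hn]. }
    destruct HG' as [n Hn]. exists n. eapply prv_cut; eauto.
  - intros [n Hn]. exact (Hc n Hn).
  - intros q. destruct (enum_form_surj q) as [n <-].
    destruct (Hd n) as (_ & _ & [H|H] & _); eauto.
  - intros q. destruct (enum_form_surj (falln q)) as [n Hn].
    destruct (Hd n) as (_ & _ & _ & H & _).
    destruct (H q Hn) as [H'|[t H']]; [rewrite Hn in H'|]; eauto.
  - intros q. destruct (enum_form_surj (falls q)) as [n Hn].
    destruct (Hd n) as (_ & _ & _ & _ & H).
    destruct (H q Hn) as [H'|[t H']]; [rewrite Hn in H'|]; eauto.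
  - exists 0. apply prv_hyp. now left.
Qed.

(** * Models and satisfaction *)

Record model := {
  num : Type;
  sets : Type;
  mo_zero : num;
  mo_one : num;
  mo_add : num -> num -> num;
  mo_mul : num -> num -> num;
  mo_lt : num -> num -> Prop;
  mo_mem : num -> sets -> Prop
}.

Arguments mo_zero {_}.
Arguments mo_one {_}.
Arguments mo_add {_} _ _.
Arguments mo_mul {_} _ _.
Arguments mo_lt {_} _ _.
Arguments mo_mem {_} _ _.

Fixpoint teval {M} (e : nat -> num M) (t : term) : num M :=
  match t with
  | tvar i => e i
  | tzero => mo_zero
  | tone => mo_one
  | tadd s t => mo_add (teval e s) (teval e t)
  | tmul s t => mo_mul (teval e s) (teval e t)
  end.

Fixpoint sat {M} (e : nat -> num M) (r : nat -> sets M) (p : form) : Prop :=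
  match p with
  | fbot => False
  | feq s t => teval e s = teval e t
  | flt s t => mo_lt (teval e s) (teval e t)
  | fmem t X => mo_mem (teval e t) (r X)
  | fimp p q => sat e r p -> sat e r q
  | falln p => forall x, sat (scons x e) r p
  | falls p => forall X, sat e (scons X r) p
  end.

(** Quantifying over all assignments matches the reading of axioms with free variables as universal
    closures. *)
Definition models (M : model) (T : form -> Prop) : Prop :=
  forall p e r, T p -> @sat M e r p.

(** * The term model of a Henkin set *)

Section TermModel.
Variables T Omega : form -> Prop.
Hypothesis HO : henkin T Omega.

Lemma henkin_imp p q : Omega (fimp p q) <-> (Omega p -> Omega q).
Proof.
  split.
  - intros H1 H2. apply (henkin_prv _ _ HO [fimp p q; p]).
    + now intros r [<-|[<-|[]]].
    + apply prv_impE with p; apply prv_hyp; cbn; auto.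
  - intros H. destruct (henkin_decides _ _ HO p) as [Hp|Hp].
    + apply (henkin_prv _ _ HO [q]); [now intros r [<-|[]]; apply H|].
      apply prv_impI, prv_hyp. cbn; auto.
    + apply (henkin_prv _ _ HO [fneg p]); [now intros r [<-|[]]|].
      apply prv_impI, prv_raa. apply prv_impE with p; apply prv_hyp; cbn; auto.
Qed.

Lemma henkin_neg p : Omega (fneg p) -> ~ Omega p.
Proof. intros H H'. apply (henkin_bot _ _ HO). now apply (proj1 (henkin_imp p _)). Qed.

Lemma henkin_allnP p : Omega (falln p) <-> forall t, Omega (instn t p).
Proof.
  split; [intros H t|intros H].
  - apply (henkin_prv _ _ HO [falln p]); [now intros r [<-|[]]|].
    apply prv_allnE, prv_hyp. now left.
  - destruct (henkin_alln _ _ HO p) as [Hp|[t Ht]]; [exact Hp|].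
    destruct (henkin_neg _ Ht (H t)).
Qed.

Lemma henkin_allsP p : Omega (falls p) <-> forall X, Omega (insts X p).
Proof.
  split; [intros H t|intros H].
  - apply (henkin_prv _ _ HO [falls p]); [now intros r [<-|[]]|].
    apply prv_allsE, prv_hyp. now left.
  - destruct (henkin_alls _ _ HO p) as [Hp|[t Ht]]; [exact Hp|].
    destruct (henkin_neg _ Ht (H t)).
Qed.

Lemma henkin_refl t : Omega (feq t t).
Proof. apply (henkin_prv _ _ HO []); [easy|apply prv_refl]. Qed.

Lemma henkin_leibniz s t p : Omega (feq s t) -> Omega (instn s p) -> Omega (instn t p).
Proof.
  intros H1 H2. apply (henkin_prv _ _ HO [feq s t; instn s p]).
  - now intros r [<-|[<-|[]]].
  - apply prv_leibniz with s; apply prv_hyp; cbn; auto.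
Qed.

Lemma henkin_sym s t : Omega (feq s t) -> Omega (feq t s).
Proof.
  intros H. pose proof (henkin_leibniz s t (feq (tvar 0) (tshift s)) H) as H'.
  unfold instn, tshift in H'. cbn in H'. rewrite !tsubst_comp in H'. cbn in H'.
  rewrite !tsubst_id in H'. apply H', henkin_refl.
Qed.

Definition term_class (t : term) : term -> Prop := fun s => Omega (feq t s).

(** A quotient is needed because [sat] interprets [feq] as genuine equality; a class is encoded as
    the predicate of its members. *)
Definition term_num : Type := {C : term -> Prop | exists t, C = term_class t}.

Definition to_num (t : term) : term_num := exist _ (term_class t) (ex_intro _ t eq_refl).

Lemma to_num_surj x : exists t, x = to_num t.
Proof.
  destruct x as [C [t ->]]. now exists t.
Qed.

Definition repr (x : term_num) : term := epsilon (inhabits tzero) (fun t => x = to_num t).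

Lemma to_num_repr x : to_num (repr x) = x.
Proof. symmetry. apply (epsilon_spec _ (fun t => x = to_num t)), to_num_surj. Qed.

(** The Leibniz rule replaces one term at a time, so it is applied first to place 0 and then to
    place 1. *)
Lemma henkin_congr s s' t t' :
  Omega (feq s s') -> Omega (feq t t') -> forall p,
  Omega (fsubst (scons s (scons t tvar)) (fun i => i) p) ->
  Omega (fsubst (scons s' (scons t' tvar)) (fun i => i) p).
Proof.
  intros Hs Ht p H.
  pose proof (henkin_leibniz s s' (fsubst (upn (scons t tvar)) (fun i => i) p) Hs) as H1.
  rewrite !instn_fsubst_upn in H1. apply H1 in H. clear H1.
  (* [tau] fills place 0 with the new term and moves place 1 to index 0, where the Leibniz rule
     acts. *)
  set (tau := fun i => match i with 0 => tshift s' | 1 => tvar 0 | S (S i) => tvar (S i) end).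
  pose proof (henkin_leibniz t t' (fsubst tau (fun i => i) p) Ht) as H1.
  assert (E : forall u, instn u (fsubst tau (fun i => i) p) =
                        fsubst (scons s' (scons u tvar)) (fun i => i) p).
  { intros u. unfold instn. rewrite fsubst_comp. f_equal. extensionality i.
    destruct i as [|[|i]]; cbn; try easy.
    unfold tshift. rewrite tsubst_comp. apply tsubst_id. }
  rewrite !E in H1. now apply H1.
Qed.

Lemma to_num_eq s t : to_num s = to_num t <-> Omega (feq s t).
Proof.
  split; intros H.
  - apply (f_equal (@proj1_sig _ _)) in H. cbn in H.
    change (term_class s t). rewrite H. apply henkin_refl.
  - apply subset_eq_compat. extensionality u. apply propositional_extensionality.
    unfold term_class. split; intros H'.
    + exact (henkin_congr _ _ _ _ H (henkin_refl u) (feq (tvar 0) (tvar 1)) H').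
    + exact (henkin_congr _ _ _ _ (henkin_sym _ _ H) (henkin_refl u)
               (feq (tvar 0) (tvar 1)) H').
Qed.

Lemma henkin_repr t : Omega (feq (repr (to_num t)) t).
Proof. apply to_num_eq, to_num_repr. Qed.

Lemma henkin_repr_iff s t p :
  Omega (fsubst (scons (repr (to_num s)) (scons (repr (to_num t)) tvar)) (fun i => i) p)
  <-> Omega (fsubst (scons s (scons t tvar)) (fun i => i) p).
Proof.
  split; apply henkin_congr; try apply henkin_repr; apply henkin_sym, henkin_repr.
Qed.

Definition term_model : model := {|
  num := term_num;
  sets := nat;
  mo_zero := to_num tzero;
  mo_one := to_num tone;
  mo_add x y := to_num (tadd (repr x) (repr y));
  mo_mul x y := to_num (tmul (repr x) (repr y));
  mo_lt x y := Omega (flt (repr x) (repr y));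
  mo_mem x X := Omega (fmem (repr x) X)
|}.

Lemma to_num_binop (op : term -> term -> term) :
  (forall sigma s t, tsubst sigma (op s t) = op (tsubst sigma s) (tsubst sigma t)) ->
  forall s t, to_num (op (repr (to_num s)) (repr (to_num t))) = to_num (op s t).
Proof.
  intros Hop s t. apply to_num_eq.
  (* [u] is [op s t] moved past the two places, so filling these restores it whatever terms are
     used; the equation between [op] of the places and [u] can then be transported. *)
  set (u := tsubst (fun i => tvar (S (S i))) (op s t)).
  assert (Hu : forall a b, tsubst (scons a (scons b tvar)) u = op s t).
  { intros a b. unfold u. rewrite tsubst_comp. apply tsubst_id. }
  pose proof (proj2 (henkin_repr_iff s t (feq (op (tvar 0) (tvar 1)) u))) as H.
  cbn in H. rewrite !Hu, !Hop in H. cbn in H. apply H, henkin_refl.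
Qed.

Lemma teval_term_model sigma t :
  @teval term_model (fun i => to_num (sigma i)) t = to_num (tsubst sigma t).
Proof.
  induction t as [i| | |s IHs t IHt|s IHs t IHt]; try reflexivity;
    cbn; rewrite IHs, IHt.
  - now apply (to_num_binop tadd).
  - now apply (to_num_binop tmul).
Qed.

(** The truth lemma. Number quantifiers range over classes of terms and set quantifiers over set
    variables, which are exactly the instances controlled by the Henkin conditions. *)
Lemma sat_term_model p sigma rho :
  @sat term_model (fun i => to_num (sigma i)) rho p <-> Omega (fsubst sigma rho p).
Proof.
  revert sigma rho. induction p as [|s t|s t|t X|p IHp q IHq|p IHp|p IHp];
    intros sigma rho; cbn -[term_model]; rewrite ?teval_term_model.
  - split; [easy|apply (henkin_bot _ _ HO)].
  - apply to_num_eq.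
  - exact (henkin_repr_iff _ _ (flt (tvar 0) (tvar 1))).
  - exact (henkin_repr_iff _ (tsubst sigma t) (fmem (tvar 0) (rho X))).
  - now rewrite henkin_imp, IHp, IHq.
  - rewrite henkin_allnP.
    assert (E : forall t, scons (to_num t) (fun i => to_num (sigma i)) =
                          fun i => to_num (scons t sigma i)).
    { intros t. extensionality i. now destruct i. }
    split.
    + intros H t. rewrite instn_fsubst_upn, <- IHp, <- E. apply H.
    + intros H x. destruct (to_num_surj x) as [t ->].
      rewrite E, IHp, <- instn_fsubst_upn. apply H.
  - rewrite henkin_allsP. split; intros H X; specialize (H X); revert H;
      rewrite insts_fsubst_ups, <- IHp; easy.
Qed.

Lemma sat_term_model_repr p e r :
  @sat term_model e r p <-> Omega (fsubst (fun i => repr (e i)) r p).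
Proof.
  rewrite <- sat_term_model. replace (fun i => to_num (repr (e i))) with e; [easy|].
  extensionality i. symmetry. apply to_num_repr.
Qed.

Lemma term_model_models : models term_model T.
Proof.
  intros p e r Hp. apply sat_term_model_repr, (henkin_prv _ _ HO []); [easy|].
  now apply prv_ax_subst.
Qed.

End TermModel.

Theorem completeness T p :
  (forall M, models M T -> forall e r, @sat M e r p) -> T ⊢ p.
Proof.
  intros H. apply NNPP. intros Hp.
  destruct (lindenbaum T p Hp) as (Omega & HO & Hneg).
  (* With the identity substitution, the truth lemma concerns the assignment of each variable to its
     own class. *)
  apply (henkin_neg T Omega HO p Hneg). rewrite <- (fsubst_id p).
  apply (sat_term_model T Omega HO). apply H, (term_model_models T Omega HO).
Qed.

(** * Semantics of connectives and substitution *)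

Section Semantics.
Context {M : model}.
Implicit Types (e : nat -> num M) (r : nat -> sets M).

Lemma teval_subst e sigma t :
  teval e (tsubst sigma t) = teval (fun i => teval e (sigma i)) t.
Proof. induction t; cbn; congruence. Qed.

Lemma sat_subst e r sigma rho p :
  sat e r (fsubst sigma rho p) <->
  sat (fun i => teval e (sigma i)) (fun i => r (rho i)) p.
Proof.
  revert e r sigma rho.
  induction p as [|s t|s t|t X|p IHp q IHq|p IHp|p IHp]; intros e r sigma rho; cbn;
    rewrite ?teval_subst; try easy.
  - now rewrite IHp, IHq.
  - assert (E : forall x, (fun i => teval (scons x e) (upn sigma i)) =
                          scons x (fun i => teval e (sigma i))).
    { intros x. extensionality i. destruct i as [|i]; [easy|].
      cbn. unfold tshift. now rewrite teval_subst. }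
    split; intros H x; specialize (H x);
      [rewrite <- E; now apply IHp|apply IHp; now rewrite E].
  - assert (E : forall X, (fun i => scons X r (ups rho i)) = scons X (fun i => r (rho i))).
    { intros X. extensionality i. now destruct i. }
    split; intros H X; specialize (H X);
      [rewrite <- E; now apply IHp|apply IHp; now rewrite E].
Qed.

Lemma sat_fimp e r p q (P Q : Prop) :
  (sat e r p <-> P) -> (sat e r q <-> Q) -> (sat e r (fimp p q) <-> (P -> Q)).
Proof. cbn. tauto. Qed.

Lemma sat_fneg e r p (P : Prop) : (sat e r p <-> P) -> (sat e r (fneg p) <-> ~ P).
Proof. cbn. tauto. Qed.

(** The defined connectives unfold to implications into falsity; reading them as the connectives of
    the metatheory takes classical logic. *)
Lemma sat_fand e r p q (P Q : Prop) :
  (sat e r p <-> P) -> (sat e r q <-> Q) -> (sat e r (fand p q) <-> P /\ Q).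
Proof. cbn. tauto. Qed.

Lemma sat_for e r p q (P Q : Prop) :
  (sat e r p <-> P) -> (sat e r q <-> Q) -> (sat e r (for_ p q) <-> P \/ Q).
Proof. cbn. tauto. Qed.

Lemma sat_fiff e r p q (P Q : Prop) :
  (sat e r p <-> P) -> (sat e r q <-> Q) -> (sat e r (fiff p q) <-> (P <-> Q)).
Proof. cbn. tauto. Qed.

Lemma sat_falln e r p (P : num M -> Prop) :
  (forall x, sat (scons x e) r p <-> P x) -> (sat e r (falln p) <-> forall x, P x).
Proof. cbn. firstorder. Qed.

Lemma sat_falls e r p (P : sets M -> Prop) :
  (forall X, sat e (scons X r) p <-> P X) -> (sat e r (falls p) <-> forall X, P X).
Proof. cbn. firstorder. Qed.

Lemma sat_fexn e r p (P : num M -> Prop) :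
  (forall x, sat (scons x e) r p <-> P x) -> (sat e r (fexn p) <-> exists x, P x).
Proof.
  intros H. cbn. split.
  - intros H'. apply NNPP. firstorder.
  - firstorder.
Qed.

Lemma sat_fexs e r p (P : sets M -> Prop) :
  (forall X, sat e (scons X r) p <-> P X) -> (sat e r (fexs p) <-> exists X, P X).
Proof.
  intros H. cbn. split.
  - intros H'. apply NNPP. firstorder.
  - firstorder.
Qed.

End Semantics.

(** * Evaluation of concrete formulas and recognition of bounded ones *)

Ltac normalize_form p := eval cbv -[fand for_ fiff fneg fexn fexs] in p.

(** The defined connectives have been kept folded, so the head symbol selects the lemma; at atoms
    both sides are convertible. *)
Ltac sat_iff_rec :=
  lazymatch goal with
  | |- sat _ _ (fand _ _) <-> _ => apply sat_fand; sat_iff_rec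
  | |- sat _ _ (for_ _ _) <-> _ => apply sat_for; sat_iff_rec
  | |- sat _ _ (fiff _ _) <-> _ => apply sat_fiff; sat_iff_rec
  | |- sat _ _ (fneg _) <-> _ => apply sat_fneg; sat_iff_rec
  | |- sat _ _ (fimp _ _) <-> _ => apply sat_fimp; sat_iff_rec
  | |- sat _ _ (fexn _) <-> _ => apply sat_fexn; intro; sat_iff_rec
  | |- sat _ _ (fexs _) <-> _ => apply sat_fexs; intro; sat_iff_rec
  | |- sat _ _ (falln _) <-> _ => apply sat_falln; intro; sat_iff_rec
  | |- sat _ _ (falls _) <-> _ => apply sat_falls; intro; sat_iff_rec
  | _ => exact (iff_refl _)
  end.

Ltac sat_iff :=
  lazymatch goal with
  | |- sat ?e ?r ?p <-> ?P =>
      let q := normalize_form p in change (sat e r q <-> P); sat_iff_rec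
  end.

(** After normalization the bound is no longer visibly a [tshift], so its unshifted form is supplied
    explicitly. *)
Ltac delta00_rec :=
  lazymatch goal with
  | |- Delta00 (fexn (fand (flt (tvar 0) (tadd (tvar (S ?k)) tone)) _)) =>
      apply (Delta00_ex (tadd (tvar k) tone)); delta00_rec
  | |- Delta00 (fand _ _) => repeat apply Delta00_imp; try apply Delta00_bot; delta00_rec
  | |- Delta00 (for_ _ _) => repeat apply Delta00_imp; try apply Delta00_bot; delta00_rec
  | |- Delta00 (fneg _) => apply Delta00_imp; [delta00_rec|apply Delta00_bot]
  | |- Delta00 (fimp _ _) => apply Delta00_imp; delta00_rec
  | |- _ => constructor
  end.

Ltac delta00 :=
  lazymatch goal with
  | |- Delta00 ?p => let q := normalize_form p in change (Delta00 q); delta00_rec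
  end.

(* Free variables of an [fm] that is used at depth 0. *)
Definition npar (n : nat) : tm := fun d => tvar (d + n).
Definition spar (n : nat) : sv := fun e => e + n.

(** Variable 1 is the candidate element, as [comprehension] reserves variable 0 for a dummy; set
    variables 0 and 1 stand for the order's domain and relation. The bounds cost nothing, since
    components of a pair never exceed its code. *)
Definition base_form : fm :=
  (let u := npar 1 in
   ∃n z, z ≺ u + 1 ∧ ∃n n, n ≺ u + 1 ∧ ∃n x, x ≺ u + 1 ∧ ∃n b, b ≺ u + 1 ∧
     u ≡ pair z n ∧ n ≡ pair x b ∧ z ∈ spar 0 ∧ x ∈ spar 0 ∧
     (z ≡ x ∨ pair z x ∈ spar 1 ∧ ¬ z ≺ b))%fm.

Definition refinement_form : fm :=
  (let u := npar 1 in
   ∃n x, x ≺ u + 1 ∧ ∃n m, m ≺ u + 1 ∧ ∃n n, n ≺ u + 1 ∧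
     x ∈ spar 0 ∧ u ≡ pair (triple x m n) (pair x (m + n)))%fm.

Definition lower_set_form : fm :=
  (npar 1 ∈ spar 0 ∧ pair (npar 1) (npar 2) ∈ spar 1)%fm.

Declare Scope num_scope.
Delimit Scope num_scope with num.
Bind Scope num_scope with num.
Notation "0" := mo_zero : num_scope.
Notation "1" := mo_one : num_scope.
Notation "x + y" := (mo_add x y) : num_scope.
Notation "x * y" := (mo_mul x y) : num_scope.
Notation "x < y" := (mo_lt x y) : num_scope.

Section Models.
Variable M : model.
Hypothesis HM : models M RCA0.
Variables (e0 : nat -> num M) (r0 : nat -> sets M).
Local Open Scope num_scope.
Implicit Types (e : nat -> num M) (r : nat -> sets M) (x y z i j : num M) (X Y U V k : sets M).

(** * Arithmetic in a model of RCA_0 *)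

Lemma sat_basic n : (n < length basic_axioms)%nat ->
  sat e0 r0 (close (nth n basic_axioms (fun _ _ => fbot))).
Proof. intros Hn. apply HM, RCA0_basic. now apply nth_In. Qed.

Lemma succ_neq_0 x : x + 1 <> 0.
Proof. exact (sat_basic 0 ltac:(cbn; lia) x). Qed.

Lemma succ_inj x y : x + 1 = y + 1 -> x = y.
Proof. exact (sat_basic 1 ltac:(cbn; lia) x y). Qed.

Lemma add_0_r x : x + 0 = x.
Proof. exact (sat_basic 2 ltac:(cbn; lia) x). Qed.

Lemma add_succ_r x y : x + (y + 1) = x + y + 1.
Proof. exact (sat_basic 3 ltac:(cbn; lia) x y). Qed.

Lemma mul_0_r x : x * 0 = 0.
Proof. exact (sat_basic 4 ltac:(cbn; lia) x). Qed.

Lemma mul_succ_r x y : x * (y + 1) = x * y + x.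
Proof. exact (sat_basic 5 ltac:(cbn; lia) x y). Qed.

Lemma nlt_0_r x : ~ x < 0.
Proof. exact (sat_basic 6 ltac:(cbn; lia) x). Qed.

Lemma lt_succ_r x y : x < y + 1 <-> x < y \/ x = y.
Proof.
  pose proof (sat_basic 7 ltac:(cbn; lia) x y) as H. revert H. apply sat_fiff; sat_iff.
Qed.

(* [q] is the matrix of a Sigma01 formula: its variable 0 is the witness, its variable 1
   the distinguished variable of the schema. *)
Lemma induction (P : num M -> Prop) q e r :
  Delta00 q -> (forall x, P x <-> exists y, sat (scons y (scons x e)) r q) ->
  P 0 -> (forall x, P x -> P (x + 1)) -> forall x, P x.
Proof.
  intros Hq HP H0 HS x.
  (* [sat_subst] produces assignments that agree with [scons x e] only after case analysis on the
     index, hence the equation as a premise. *)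
  assert (HP' : forall x e', e' = scons x e -> (sat e' r (fexn q) <-> P x)).
  { intros x' e' ->. rewrite HP. now apply sat_fexn. }
  apply (HP' x _ eq_refl).
  apply (HM _ e r (RCA0_induction _ (ex_intro _ q (conj Hq eq_refl)))).
  apply (sat_fand e r _ _ (P 0) (forall x, P x -> P (x + 1))); [| |easy].
  - unfold instn. rewrite sat_subst. apply HP'. extensionality i. now destruct i.
  - apply sat_falln. intros y. apply sat_fimp; [now apply HP'|].
    unfold succ_inst. rewrite sat_subst. apply HP'. extensionality i. now destruct i.
Qed.

(* Variable 0 of [q] is a dummy, so that [fexn q] and [falln q] are equivalent. *)
Lemma comprehension (P : num M -> Prop) q e r :
  Delta00 q -> (forall x y, P x <-> sat (scons y (scons x e)) r q) ->
  exists X, forall x, mo_mem x X <-> P x.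
Proof.
  intros Hq HP.
  assert (HP1 : forall x, sat (scons x e) r (fexn q) <-> P x).
  { intros x. rewrite (sat_fexn _ _ q (fun _ => P x)); [|firstorder].
    split; [now intros []|intros H; now exists 0]. }
  assert (HP2 : forall x, sat (scons x e) r (falln q) <-> P x).
  { intros x. rewrite (sat_falln _ _ q (fun _ => P x)); [|firstorder].
    split; [intros H; exact (H 0)|easy]. }
  assert (E : sat e r (comprehension_ax (fexn q) (falln q)) <->
              ((forall x, P x <-> P x) -> exists X, forall x, mo_mem x X <-> P x)).
  { apply sat_fimp.
    - apply sat_falln. intros x. now apply sat_fiff.
    - apply sat_fexs. intros X. apply sat_falln. intros x. apply sat_fiff; [sat_iff|].
      unfold shifts. rewrite sat_subst. apply HP1. }
  apply E; [|easy]. apply HM, RCA0_comprehension; now exists q.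
Qed.

Definition env (l : list (num M)) : nat -> num M := fun n => nth n l 0.

(** In [q] variable 0 is the dummy witness, variable 1 is the induction variable, and variables from
    2 on denote the entries of [l]. *)
Ltac induct q l :=
  lazymatch goal with |- forall x, @?P x => apply (induction P q (env l) r0) end;
    [delta00|intros ?; split; [intros ?; exists 0; assumption|intros [? ?]; assumption]| |].

Lemma add_0_l x : 0 + x = x.
Proof.
  revert x. induct (feq (tadd tzero (tvar 1)) (tvar 1)) (@nil (num M)).
  - apply add_0_r.
  - intros x H. now rewrite add_succ_r, H.
Qed.

Lemma add_succ_l x y : x + 1 + y = x + y + 1.
Proof.
  revert y. induct (feq (tadd (tadd (tvar 2) tone) (tvar 1))
                        (tadd (tadd (tvar 2) (tvar 1)) tone)) [x].
  - now rewrite !add_0_r.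
  - intros y H. now rewrite !add_succ_r, H.
Qed.

Lemma add_comm x y : x + y = y + x.
Proof.
  revert y. induct (feq (tadd (tvar 2) (tvar 1)) (tadd (tvar 1) (tvar 2))) [x].
  - now rewrite add_0_r, add_0_l.
  - intros y H. now rewrite add_succ_r, add_succ_l, H.
Qed.

Lemma add_assoc x y z : x + (y + z) = x + y + z.
Proof.
  revert z. induct (feq (tadd (tvar 2) (tadd (tvar 3) (tvar 1)))
                        (tadd (tadd (tvar 2) (tvar 3)) (tvar 1))) [x; y].
  - now rewrite !add_0_r.
  - intros z H. now rewrite !add_succ_r, H.
Qed.

Lemma mul_0_l x : 0 * x = 0.
Proof.
  revert x. induct (feq (tmul tzero (tvar 1)) tzero) (@nil (num M)).
  - apply mul_0_r.
  - intros x H. now rewrite mul_succ_r, H, add_0_r.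
Qed.

Lemma mul_succ_l x y : (x + 1) * y = x * y + y.
Proof.
  revert y. induct (feq (tmul (tadd (tvar 2) tone) (tvar 1))
                        (tadd (tmul (tvar 2) (tvar 1)) (tvar 1))) [x].
  - now rewrite !mul_0_r, add_0_r.
  - intros y H. rewrite !mul_succ_r, H, !add_succ_r, <- !(add_assoc (x * y)).
    now rewrite (add_comm x y).
Qed.

Lemma mul_comm x y : x * y = y * x.
Proof.
  revert y. induct (feq (tmul (tvar 2) (tvar 1)) (tmul (tvar 1) (tvar 2))) [x].
  - now rewrite mul_0_r, mul_0_l.
  - intros y H. now rewrite mul_succ_r, mul_succ_l, H.
Qed.

Lemma mul_1_l x : 1 * x = x.
Proof. now rewrite <- (add_0_l 1), mul_succ_l, mul_0_l, add_0_l. Qed.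

Lemma mul_add_distr_l x y z : x * (y + z) = x * y + x * z.
Proof.
  revert z. induct (feq (tmul (tvar 2) (tadd (tvar 3) (tvar 1)))
      (tadd (tmul (tvar 2) (tvar 3)) (tmul (tvar 2) (tvar 1)))) [x; y].
  - now rewrite mul_0_r, !add_0_r.
  - intros z H. now rewrite add_succ_r, !mul_succ_r, H, add_assoc.
Qed.

Lemma mul_assoc x y z : x * (y * z) = x * y * z.
Proof.
  revert z. induct (feq (tmul (tvar 2) (tmul (tvar 3) (tvar 1)))
                        (tmul (tmul (tvar 2) (tvar 3)) (tvar 1))) [x; y].
  - now rewrite !mul_0_r.
  - intros z H. now rewrite !mul_succ_r, mul_add_distr_l, H.
Qed.

Lemma num_semiring : @semi_ring_theory (num M) 0 1 mo_add mo_mul eq.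
Proof.
  constructor; auto using add_0_l, add_comm, add_assoc, mul_1_l, mul_0_l, mul_comm, mul_assoc.
  intros x y z. now rewrite !(mul_comm _ z), mul_add_distr_l.
Qed.

Add Ring num_ring : num_semiring.

Lemma add_cancel_r x y z : x + z = y + z -> x = y.
Proof.
  revert z. induct (fimp (feq (tadd (tvar 2) (tvar 1)) (tadd (tvar 3) (tvar 1)))
                         (feq (tvar 2) (tvar 3))) [x; y].
  - now rewrite !add_0_r.
  - intros z IH H. apply IH, succ_inj. now rewrite <- !add_succ_r.
Qed.

Lemma add_succ_neq x y : x <> x + (y + 1).
Proof.
  intros H. apply (succ_neq_0 y), (add_cancel_r _ _ x).
  rewrite add_0_l, (add_comm _ x). now symmetry.
Qed.

Lemma lt_add_succ x y : x < x + y + 1.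
Proof.
  revert y. induct (flt (tvar 2) (tadd (tadd (tvar 2) (tvar 1)) tone)) [x].
  - rewrite add_0_r. apply lt_succ_r. now right.
  - intros y H. apply lt_succ_r. left. now rewrite add_assoc.
Qed.

(** Reduces order facts to polynomial identities. For the induction on [y] the existential is pulled
    in front of the implication, which makes the formula Σ⁰₁ and is classically equivalent. *)
Lemma lt_ex x y : x < y <-> exists z, y = x + z + 1.
Proof.
  split; [|intros [z ->]; apply lt_add_succ].
  revert y. apply (induction (fun y => x < y -> exists z, y = x + z + 1)
    (fimp (flt (tvar 2) (tvar 1)) (feq (tvar 1) (tadd (tadd (tvar 2) (tvar 0)) tone))) (env [x]) r0).
  - delta00.
  - intros y. cbn. split.
    + intros H. destruct (classic (x < y)) as [Hxy|Hxy].
      * destruct (H Hxy) as [z Hz]. now exists z.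
      (* The implication is vacuous here, so any witness serves. *)
      * now exists 0.
    + intros [z H] Hxy. exists z. now apply H.
  - intros H. now apply nlt_0_r in H.
  - intros y IH H. apply lt_succ_r in H as [H| ->].
    + destruct (IH H) as [z ->]. exists (z + 1). ring.
    + exists 0. ring.
Qed.

Lemma lt_trans x y z : x < y -> y < z -> x < z.
Proof.
  rewrite !lt_ex. intros [a ->] [b ->]. exists (a + b + 1). ring.
Qed.

Lemma lt_add_r x y z : x < y -> x < y + z.
Proof. rewrite !lt_ex. intros [a ->]. exists (a + z). ring. Qed.

Lemma zero_or_succ x : x = 0 \/ exists y, x = y + 1.
Proof.
  revert x. apply (induction _ (for_ (feq (tvar 1) tzero)
    (feq (tvar 1) (tadd (tvar 0) tone))) (env []) r0).
  - delta00.
  - intros x. split.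
    + intros [H|[y H]]; [exists 0|exists y]; cbn; tauto.
    + intros [y H]. destruct (classic (x = 0)); [now left|].
      right. exists y. now apply H.
  - now left.
  - intros x _. right. now exists x.
Qed.

Lemma lt_total x y : x < y \/ x = y \/ y < x.
Proof.
  revert x. apply (induction _ (for_ (flt (tvar 1) (tvar 2))
    (for_ (feq (tvar 1) (tvar 2)) (flt (tvar 2) (tvar 1)))) (env [y]) r0).
  - delta00.
  - intros x. cbn. split; [intros H; exists 0; tauto|intros [_ H]; tauto].
  - destruct (zero_or_succ y) as [->|[z ->]]; [tauto|].
    left. apply lt_ex. exists z. ring.
  - intros x [H|[->|H]].
    + apply lt_ex in H as [z ->]. destruct (zero_or_succ z) as [->|[w ->]].
      * right; left. ring.
      * left. apply lt_ex. exists w. ring.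
    + right; right. apply lt_succ_r. now right.
    + right; right. apply lt_succ_r. now left.
Qed.

(** * The pairing function *)

Definition npair i j := (i + j) * (i + j) + i.

(* If [i + j < i' + j'], then [(i' + j')^2] already exceeds [(i + j)^2 + i]. *)
Lemma npair_neq i j i' j' : i + j < i' + j' -> npair i j <> npair i' j'.
Proof.
  intros [z Hz]%lt_ex H. unfold npair in H. rewrite Hz in H.
  (* The term below is the difference of the two codes less one: with [s = i + j], expand
     [(s + z + 1)^2 + i'], then subtract [s^2 + i] and 1. *)
  apply (add_succ_neq (npair i j)
    ((i + j) * z + (i + j) * z + i + j + j + z * z + z + z + i')).
  unfold npair. rewrite H at 1. ring.
Qed.

(** Different sums are excluded by [npair_neq]; for equal sums the squares cancel. *)
Lemma npair_inj i j i' j' : npair i j = npair i' j' -> i = i' /\ j = j'.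
Proof.
  intros H. destruct (lt_total (i + j) (i' + j')) as [Hlt|[Heq|Hlt]].
  - now apply npair_neq in Hlt.
  - unfold npair in H. rewrite Heq, !(add_comm (_ * _)) in H.
    apply add_cancel_r in H as <-. split; [easy|].
    rewrite !(add_comm i) in Heq. now apply add_cancel_r in Heq.
  - apply npair_neq in Hlt. now symmetry in H.
Qed.

Lemma lt_npair_l i j : i < npair i j + 1.
Proof. apply lt_ex. exists ((i + j) * (i + j)). unfold npair. ring. Qed.

Lemma lt_npair_r i j : j < npair i j + 1.
Proof.
  apply lt_ex. unfold npair. destruct (zero_or_succ j) as [->|[k ->]].
  - exists (npair i 0). unfold npair. ring.
  (* One copy of [i + k + 1] is split off from the square; it contains [j = k + 1] and leaves
     [i]. *)
  - exists ((i + k + 1) * (i + k) + i + i). ring.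
Qed.

(** * GST_1 and ADS in a model *)

Definition nrow U x n := mo_mem (npair x n) U.

Definition ntriple x m n := npair (npair x m) n.

Definition nsubset (A B : num M -> Prop) := forall x, A x -> B x.

Definition nfinite (A : num M -> Prop) := exists b, forall x, A x -> x < b.

Definition is_function3 X k :=
  (forall z, mo_mem z k ->
     exists x m n j, mo_mem x X /\ z = npair (ntriple x m n) j) /\
  (forall x m n, mo_mem x X ->
     exists j, mo_mem (npair (ntriple x m n) j) k /\
               forall i, mo_mem (npair (ntriple x m n) i) k -> i = j).

Definition is_csc X U k :=
  (forall i, nsubset (fun x => nrow U x i) (fun x => mo_mem x X)) /\
  (forall x, mo_mem x X -> exists i, nrow U x i) /\
  is_function3 X k /\
  (forall x m n, nrow U x m /\ nrow U x n ->
     forall j, mo_mem (npair (ntriple x m n) j) k ->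
       nrow U x j /\
       nsubset (fun z => nrow U z j) (fun z => nrow U z m /\ nrow U z n)).

Definition is_T1 X U :=
  forall x y, mo_mem x X /\ mo_mem y X /\ x <> y ->
    exists m n, (nrow U x m /\ ~ nrow U x n) /\ (nrow U y n /\ ~ nrow U y m).

Definition nsubspace U Y x n := nrow U x n /\ mo_mem x Y.

Definition is_discrete Y (B : num M -> num M -> Prop) :=
  forall x, mo_mem x Y -> exists i, forall z, B z i <-> z = x.

Definition is_open (B : num M -> num M -> Prop) V :=
  forall x, mo_mem x V -> exists i, B x i /\ nsubset (fun z => B z i) (fun z => mo_mem z V).

Definition is_cofinite Y (B : num M -> num M -> Prop) :=
  ~ nfinite (fun x => mo_mem x Y) /\
  forall V, nsubset (fun x => mo_mem x V) (fun x => mo_mem x Y) ->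
    (is_open B V <->
     ((forall x, ~ mo_mem x V) \/ nfinite (fun x => mo_mem x Y /\ ~ mo_mem x V))).

Definition GST1_holds :=
  forall X U k,
    is_csc X U k /\ ~ nfinite (fun x => mo_mem x X) /\ is_T1 X U ->
    exists Y, nsubset (fun x => mo_mem x Y) (fun x => mo_mem x X) /\
      ~ nfinite (fun x => mo_mem x Y) /\
      (is_discrete Y (nsubspace U Y) \/ is_cofinite Y (nsubspace U Y)).

Definition is_linear_order L R :=
  (forall z, mo_mem z R -> exists x y, mo_mem x L /\ mo_mem y L /\ z = npair x y) /\
  (forall x, mo_mem x L -> mo_mem (npair x x) R) /\
  (forall x y, mo_mem (npair x y) R /\ mo_mem (npair y x) R -> x = y) /\
  (forall x y z, mo_mem (npair x y) R /\ mo_mem (npair y z) R -> mo_mem (npair x z) R) /\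
  (forall x y, mo_mem x L /\ mo_mem y L ->
     mo_mem (npair x y) R \/ mo_mem (npair y x) R).

Definition is_ascending R Y :=
  forall y, mo_mem y Y -> nfinite (fun z => mo_mem z Y /\ mo_mem (npair z y) R).

Definition is_descending R Y :=
  forall y, mo_mem y Y -> nfinite (fun z => mo_mem z Y /\ mo_mem (npair y z) R).

Definition ADS_holds :=
  forall L R, is_linear_order L R /\ ~ nfinite (fun x => mo_mem x L) ->
    exists Y, nsubset (fun x => mo_mem x Y) (fun x => mo_mem x L) /\
      ~ nfinite (fun x => mo_mem x Y) /\ (is_ascending R Y \/ is_descending R Y).

(** The semantic notions repeat the formulas connective by connective, so once unfolded they match
    without further argument. *)
Lemma sat_GST1 e r : sat e r GST1 <-> GST1_holds.
Proof.
  cbv delta [GST1_holds is_csc is_function3 is_T1 is_discrete is_cofinite is_open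
    nsubspace nsubset nfinite nrow ntriple npair]. sat_iff.
Qed.

Lemma sat_ADS e r : sat e r ADS <-> ADS_holds.
Proof.
  cbv delta [ADS_holds is_linear_order is_ascending is_descending nsubset nfinite npair].
  sat_iff.
Qed.

(** * From GST_1 to ADS *)

(* The basic open set of index [npair x b] is [{x} ∪ {z ≤_L x : b ≤ z}]. *)
Definition base_mem L R z n :=
  exists x b, n = npair x b /\ mo_mem z L /\ mo_mem x L /\
    (z = x \/ mo_mem (npair z x) R /\ ~ z < b).

(** Comprehension applies to the version with all quantifiers bounded by the code; the bounds are
    then removed, as components are at most their pair. *)
Lemma base_ex L R : exists U, forall z n, nrow U z n <-> base_mem L R z n.
Proof.
  destruct (comprehension
    (fun u => exists z, z < u + 1 /\ exists n, n < u + 1 /\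
       exists x, x < u + 1 /\ exists b, b < u + 1 /\
         u = npair z n /\ n = npair x b /\ mo_mem z L /\ mo_mem x L /\
         (z = x \/ mo_mem (npair z x) R /\ ~ z < b))
    (base_form 0%nat 0%nat) e0 (scons L (scons R r0))) as [U HU].
  - delta00.
  - intros u y. symmetry. cbv delta [npair]. sat_iff.
  - exists U. intros z n. unfold nrow. rewrite HU. split.
    + intros (z' & _ & n' & _ & x & _ & b & _ & E & H).
      apply npair_inj in E as [<- <-]. exists x, b. exact H.
    + intros (x & b & -> & H). exists z. split; [apply lt_npair_l|].
      exists (npair x b). split; [apply lt_npair_r|].
      assert (Hlt : npair x b < npair z (npair x b) + 1) by apply lt_npair_r.
      (* [x] and [b] are nested one level deeper, so their bound passes through the inner pair. *)
      assert (Htr : forall a, a < npair x b + 1 -> a < npair z (npair x b) + 1).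
      { intros a [Ha| ->]%lt_succ_r; [|exact Hlt]. apply lt_trans with (npair x b); auto. }
      exists x. split; [apply Htr, lt_npair_l|].
      exists b. split; [apply Htr, lt_npair_r|]. easy.
Qed.

(* Since [b < npair x b + 1], the threshold [m + n] is above those of both [m] and [n]. *)
Lemma refinement_ex L :
  exists k, forall u, mo_mem u k <->
    exists x m n, mo_mem x L /\ u = npair (ntriple x m n) (npair x (m + n)).
Proof.
  destruct (comprehension
    (fun u => exists x, x < u + 1 /\ exists m, m < u + 1 /\ exists n, n < u + 1 /\
       mo_mem x L /\ u = npair (ntriple x m n) (npair x (m + n)))
    (refinement_form 0%nat 0%nat) e0 (scons L r0)) as [k Hk].
  - delta00.
  - intros u y. symmetry. cbv delta [npair ntriple]. sat_iff.
  - exists k. intros u. rewrite Hk. split.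
    + intros (x & _ & m & _ & n & _ & H). now exists x, m, n.
    + intros (x & m & n & Hx & ->).
      (* Transitivity of [≤], which is written as [<] with the right side increased by one. *)
      assert (Hle : forall a b c : num M, a < b + 1 -> b < c + 1 -> a < c + 1).
      { intros a b c Ha [Hb| ->]%lt_succ_r; [|exact Ha].
        apply lt_succ_r in Ha as [Ha| ->]; apply lt_succ_r; left; [|exact Hb].
        now apply lt_trans with b. }
      set (t := ntriple x m n). set (v := npair t _).
      assert (Ht : t < v + 1) by apply lt_npair_l.
      assert (Hxm : npair x m < v + 1) by (apply (Hle _ t); [apply lt_npair_l|exact Ht]).
      exists x. split; [apply (Hle _ (npair x m)); [apply lt_npair_l|exact Hxm]|].
      exists m. split; [apply (Hle _ (npair x m)); [apply lt_npair_r|exact Hxm]|].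
      exists n. split; [apply (Hle _ t); [apply lt_npair_r|exact Ht]|]. easy.
Qed.

(** The cofinite topology speaks only of sets of the model, so the lower cone of [y] in [Y] must be
    one. *)
Lemma lower_set_ex R Y y : exists V, forall z, mo_mem z V <-> mo_mem z Y /\ mo_mem (npair z y) R.
Proof.
  apply (comprehension _ (lower_set_form 0%nat 0%nat)
    (scons y e0) (scons Y (scons R r0))).
  - delta00.
  - intros z w. symmetry. cbv delta [npair]. sat_iff.
Qed.

(** Descends from the threshold of a refined basic set to that of an original one, as [b] is at most
    the code of its pair. *)
Lemma nlt_npair_r z x b c : ~ z < npair x b + c -> ~ z < b.
Proof.
  intros H Hz. apply H, lt_add_r.
  destruct (proj1 (lt_succ_r b _) (lt_npair_r x b)) as [Hb|Hb]; [|now rewrite <- Hb].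
  now apply lt_trans with b.
Qed.

(** * The space of a linear order *)

Section LinearOrder.
Variables L R U k : sets M.
Hypothesis HL : is_linear_order L R.
Hypothesis HU : forall z n, nrow U z n <-> base_mem L R z n.
Hypothesis Hk : forall u, mo_mem u k <->
    exists x m n, mo_mem x L /\ u = npair (ntriple x m n) (npair x (m + n)).

Lemma base_csc : is_csc L U k.
Proof.
  destruct HL as (_ & Hrefl & _ & Htrans & _).
  split; [|split; [|split; [split|]]].
  - intros n x (y & b & _ & H & _)%HU. exact H.
  (* The centre belongs to its basic set for every threshold; 0 is an arbitrary choice. *)
  - intros x Hx. exists (npair x 0). apply HU. exists x, 0. auto.
  - intros u (x & m & n & Hx & ->)%Hk. now exists x, m, n, (npair x (m + n)).
  - intros x m n Hx. exists (npair x (m + n)). split.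
    + apply Hk. now exists x, m, n.
    + intros i (x' & m' & n' & _ & H)%Hk.
      apply npair_inj in H as [H ->]. apply npair_inj in H as [H ->].
      apply npair_inj in H as [-> ->]. easy.
  - intros x m n [Hm Hn] j (x' & m' & n' & Hx & H)%Hk.
    apply npair_inj in H as [H ->]. apply npair_inj in H as [H <-].
    apply npair_inj in H as [<- <-]. split.
    { apply HU. exists x, (m + n). auto. }
    intros z (x' & b & E & Hz & _ & Hzx)%HU. apply npair_inj in E as [<- <-].
    destruct Hzx as [->|[Hzx Hlt]]; [easy|].
    (* Transitivity through [x] puts [z] below both centres [a] and [a'], and the sum of the two
       indices dominates both thresholds. *)
    apply HU in Hm as (a & b & -> & _ & Ha & Hxa), Hn as (a' & b' & -> & _ & Ha' & Hxa').
    split; apply HU.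
    + exists a, b. repeat split; auto. right. split.
      * destruct Hxa as [->|[Hxa _]]; [easy|]. now apply Htrans with x.
      * now apply nlt_npair_r in Hlt.
    + exists a', b'. repeat split; auto. right. split.
      * destruct Hxa' as [->|[Hxa' _]]; [easy|]. now apply Htrans with x.
      * rewrite add_comm in Hlt. now apply nlt_npair_r in Hlt.
Qed.

Lemma base_T1 : is_T1 L U.
Proof.
  assert (Hsep : forall x y, mo_mem x L -> x <> y ->
            nrow U x (npair x (y + 1)) /\ ~ nrow U y (npair x (y + 1))).
  { intros x y Hx Hxy. split; [apply HU; exists x, (y + 1); auto|].
    intros (x' & b & E & _ & _ & H)%HU. apply npair_inj in E as [<- <-].
    destruct H as [H|[_ H]]; [now symmetry in H|].
    apply H, lt_succ_r. now right. }
  intros x y (Hx & Hy & Hxy). exists (npair x (y + 1)), (npair y (x + 1)).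
  destruct (Hsep x y Hx Hxy), (Hsep y x Hy (not_eq_sym Hxy)). auto.
Qed.

Lemma discrete_ascending Y : is_discrete Y (nsubspace U Y) -> is_ascending R Y.
Proof.
  destruct HL as (Hdom & _ & _ & Htrans & _).
  intros H x Hx. destruct (H x Hx) as [i Hi].
  destruct (proj2 (Hi x) eq_refl) as [(a & b & -> & _ & Ha & Hxa)%HU _].
  (* The bound exceeds both the points below the threshold [b] and [x] itself. *)
  exists (b + x + 1). intros z [Hz Hzx]. apply lt_succ_r.
  destruct (classic (z < b)) as [Hb|Hb]; [left; now apply lt_add_r|].
  (* The centre [a] may differ from [x], but then [x ≤_L a], so [z] lies in the basic set that
     isolates [x]. *)
  assert (z = x) as ->.
  { apply Hi. split; [apply HU; exists a, b|exact Hz]. repeat split; auto.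
    - destruct (Hdom _ Hzx) as (z' & x' & Hz' & _ & E). now apply npair_inj in E as [-> _].
    - right. split; [|exact Hb]. destruct Hxa as [<-|[Hxa _]]; [easy|].
      now apply Htrans with x. }
  apply lt_succ_r. rewrite (add_comm b). apply lt_ex. exists b. ring.
Qed.

Lemma cofinite_descending Y :
  nsubset (fun x => mo_mem x Y) (fun x => mo_mem x L) ->
  is_cofinite Y (nsubspace U Y) -> is_descending R Y.
Proof.
  destruct HL as (_ & Hrefl & Hanti & Htrans & _).
  intros HY [_ H] y Hy. destruct (lower_set_ex R Y y) as [V HV].
  assert (Hopen : is_open (nsubspace U Y) V).
  (* With threshold 0 the basic set is the whole lower cone of [x], whose trace on [Y] lies in [V]
     by transitivity. *)
  { intros x [Hx Hxy]%HV. exists (npair x 0). split.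
    - split; [apply HU; exists x, 0; auto|exact Hx].
    - intros z [(x' & b & E & _ & _ & Hzx)%HU Hz]. apply npair_inj in E as [<- _].
      apply HV. split; [exact Hz|].
      destruct Hzx as [->|[Hzx _]]; [easy|]. now apply Htrans with x. }
  apply H in Hopen as [Hempty|[b Hb]].
  - destruct (Hempty y). apply HV. auto.
  (* [b] bounds the points of [Y] outside [V]; by antisymmetry the only point of [V] above [y] is
     [y]. *)
  - exists (b + y + 1). intros z [Hz Hyz].
    destruct (classic (mo_mem z V)) as [[_ Hzy]%HV|HzV].
    + rewrite (Hanti z y) by auto. rewrite (add_comm b). apply lt_add_succ.
    + apply lt_add_r, lt_add_r. auto.
  - intros x Hx. now apply HV.
Qed.

End LinearOrder.

Lemma GST1_ADS : GST1_holds -> ADS_holds.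
Proof.
  intros HG L R [HL Hinf].
  destruct (base_ex L R) as [U HU], (refinement_ex L) as [k Hk].
  destruct (HG L U k) as (Y & HY & HYinf & H).
  { split; [now apply (base_csc L R)|split; [exact Hinf|now apply (base_T1 L R)]]. }
  exists Y. split; [exact HY|split; [exact HYinf|]].
  destruct H as [H|H]; [left|right].
  - now apply (discrete_ascending L R U).
  - now apply (cofinite_descending L R U).
Qed.

End Models.

Theorem theorem6p5 : RCA0 ⊢ fimp GST1 ADS.
Proof.
  apply completeness. intros M HM e r. cbn [sat]. rewrite sat_GST1, sat_ADS.
  (* [e] and [r] serve as the base assignment to which the parameters of comprehension are added. *)
  now apply (GST1_ADS M HM e r).
Qed.
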